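(* Let $G=(V,E)$ be a graph with $|V|=n$, and let $1\leq k\leq \lfloor n/2\rfloor$. Let $\lambda$ be a non-trivial eigenvalue of $L_k(G)$. Then \[ k\bigl(\lambda_2(L(G))-k+1\bigr)\leq \lambda \leq k\,\lambda_n(L(G)). \]
   Context: For a graph $G=(V,E)$ and $0\le k\le |V|$, the $k$-th token graph $F_k(G)$ is the graph whose vertices are the $k$-element subsets of $V$, with $\{A,B\}$ an edge iff $|A\cap B|=k-1$ and the symmetric difference $A\triangle B$ is an edge of $G$. $L(H)$ denotes the Laplacian matrix of a graph $H$, and $L_k(G)=L(F_k(G))$. For a symmetric matrix $M$, $\lambda_i(M)$ is its $i$-th smallest eigenvalue; so $\lambda_2(L(G))$ is the second smallest and $\lambda_n(L(G))$ the largest eigenvalue of $L(G)$. For $1\le k\le\lfloor n/2\rfloor$, an eigenvalue $\lambda$ of $L_k(G)$ is called non-trivial if its multiplicity as an eigenvalue of $L_k(G)$ is larger than its multiplicity as an eigenvalue of $L_{k-1}(G)$ (multiplicity $0$ if it is not an eigenvalue). *)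

(* Defs.v *)
From HB Require Import structures.
From mathcomp Require Import all_boot all_order all_algebra.
From mathcomp Require Import polyrcf.

Set Implicit Arguments.
Unset Strict Implicit.
Unset Printing Implicit Defensive.

Import Order.TTheory GRing.Theory Num.Theory.
Local Open Scope ring_scope.

Record sgraph (V : finType) := SGraph {
  adj : rel V;
  adj_sym : symmetric adj;
  adj_irr : irreflexive adj }.

Section TokenGraph.
Variables (V : finType) (G : sgraph V) (k : nat).

(* The condition |A :&: B| = k - 1 is written |A :&: B| + 1 = k, so that it   *)
(* is not affected by truncated subtraction when k = 0.                       *)
Definition token_adj : rel {A : {set V} | #|A| == k} := fun A B =>
  (#|val A :&: val B|.+1 == k) &&
  [exists u, exists v, adj G u v &&
     ((val A :\: val B) :|: (val B :\: val A) == [set u; v])].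

Fact token_adj_sym : symmetric token_adj.
Proof. by move=> A B; rewrite /token_adj setIC setUC. Qed.

Fact token_adj_irr : irreflexive token_adj.
Proof.
move=> A; rewrite /token_adj setIid (eqP (valP A)).
by rewrite -[X in _ == X]addn0 -addn1 eqn_add2l.
Qed.

Definition token_graph : sgraph {A : {set V} | #|A| == k} :=
  SGraph token_adj_sym token_adj_irr.

End TokenGraph.

Definition degree (V : finType) (G : sgraph V) (u : V) : nat :=
  #|[set v | adj G u v]|.

(* Rows and columns follow the enumeration of V; the spectrum does not depend *)
(* on it.                                                                     *)
Definition laplacian (R : nzRingType) (V : finType) (G : sgraph V) :
    'M[R]_#|V| :=
  \matrix_(i, j) ((degree G (enum_val i))%:R *+ (i == j)
                  - (adj G (enum_val i) (enum_val j))%:R).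

(* Dimension of the eigenspace, which for a symmetric matrix is also the      *)
(* multiplicity as a root of the characteristic polynomial; it is 0 when a is *)
(* not an eigenvalue.                                                         *)
Definition multiplicity (F : fieldType) (n : nat) (M : 'M[F]_n) (a : F) : nat :=
  \rank (eigenspace M a).

(* rootsR lists each root of the characteristic polynomial once.              *)
Definition eigenvalues (R : rcfType) (n : nat) (M : 'M[R]_n) : seq R :=
  sort <=%R
    (flatten [seq nseq (multiplicity M a) a | a <- rootsR (char_poly M)]).

(* The index i starts at 1. A symmetric M has n eigenvalues, so the default   *)
(* value 0 is not used for 1 <= i <= n.                                       *)
Definition lambda (R : rcfType) (n : nat) (i : nat) (M : 'M[R]_n) : R :=
  nth 0 (eigenvalues M) i.-1.

Definition nontrivial_eigenvalue (R : rcfType) (V : finType) (G : sgraph V)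
    (k : nat) (a : R) : Prop :=
  eigenvalue (laplacian R (token_graph G k)) a /\
  (multiplicity (laplacian R (token_graph G k.-1)) a
     < multiplicity (laplacian R (token_graph G k)) a)%N.

(* Main.v *)
(* Let D be the operator from functions on k-sets to functions on (k-1)-sets
   that sums over supersets. The Laplacian of F_k(G) is the sum over the edges
   uv of G of F - F o (u v), where the transposition (u v) acts on sets, so D
   intertwines the Laplacians L_k and L_{k-1}; by a dimension count a
   non-trivial eigenvalue a has an eigenvector F with D F = 0. For a set B let
   g_B(v) = F(B + v) for v outside B and 0 on B. Then D F = 0 says that each g_B
   is orthogonal to the constants, whence
     lambda_2 |g_B|^2 <= <g_B, L g_B> <= lambda_n |g_B|^2.
   Summing over B, the norms add up to k |F|^2, and the forms to a |F|^2 plus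
   the sum over A of F(A)^2 times the number of ordered pairs of adjacent
   vertices in A, which lies between 0 and k(k-1). *)

Require Import Defs.
From HB Require Import structures.
From mathcomp Require Import all_boot all_order all_algebra.
From mathcomp Require Import perm polyrcf complex ring lra.

Set Implicit Arguments.
Unset Strict Implicit.
Unset Printing Implicit Defensive.

Import Order.TTheory GRing.Theory Num.Theory.
Local Open Scope ring_scope.

(** * Spectra of symmetric matrices over a real closed field *)

(* Diagonalized over R[i]; the eigenvalues are real, and ranks do not change
   under field extension. *)
Lemma symmetric_sum_eigenspaces (R : rcfType) (n : nat) (A : 'M[R]_n) :
  A^T = A -> (1%:M <= \sum_(r <- rootsR (char_poly A)) eigenspace A r)%MS.
Proof.
move=> symA; pose f := real_complex R : {rmorphism R -> R[i]}.
pose AC := map_mx f A.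
have ACh : AC \is hermsymmx.
  apply: realsym_hermsym.
    apply/is_hermitianmxP; rewrite expr0 scale1r map_mx_id //.
    by rewrite /AC map_trmx symA.
  by apply/mxOverP => i j; rewrite mxE complex_real.
have /orthomx_spectralP ACE := hermitian_normalmx ACh.
have dreal := hermitian_spectral_diag_real ACh.
set P := spectralmx AC in ACE; set d := spectral_diag AC in ACE dreal.
have Pu : P \in unitmx by exact: spectral_unit.
pose r i := complex.Re (d 0 i).
have dE i : d 0 i = f (r i).
  have /mxOverP/(_ 0 i) := dreal.
  by rewrite /r; case: (d 0 i) => x y; rewrite complex_real /= => /eqP->.
(* The [r i] may repeat; a nonzero eigenspace makes [r i] a root of [char_poly A], so its eigenspace
   is among those summed. *)
suff main : (1%:M <= \sum_i eigenspace A (r i))%MS.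
  apply: submx_trans main _; apply/sumsmx_subP => i _.
  have [->|nz] := eqVneq (eigenspace A (r i)) 0; first exact: sub0mx.
  have cp0 : char_poly A != 0 by rewrite monic_neq0 // char_poly_monic.
  have rin : r i \in rootsR (char_poly A).
    by rewrite -(roots_on_rootsR cp0) in_itv /= -eigenvalue_root_char.
  rewrite (big_nth 0) big_mkord; move: rin; set s := rootsR _ => rin.
  have ltr : (index (r i) s < size s)%N by rewrite index_mem.
  by rewrite (sumsmx_sup (Ordinal ltr)) //= nth_index.
rewrite -(map_submx f) map_mx1.
(* Over [R[i]] it suffices that each row of the invertible matrix [P] is an eigenvector for some
   [r i]. *)
apply: (submx_trans (B := P)); first by rewrite sub1mx row_full_unit.
apply/row_subP => i.
apply: (submx_trans (B := map_mx f (eigenspace A (r i)))); last first.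
  by rewrite map_submx (sumsmx_sup i).
rewrite map_eigenspace; apply/eigenspaceP.
rewrite -dE -/AC ACE !rowE !mulmxA mulmxK //.
by rewrite -(rowE i (diag_mx d)) row_diag_mx scalemxAl.
Qed.

(** The multiplicities add up to [n] because the eigenspaces for distinct roots form a direct sum,
    which is the whole space. *)
Lemma size_eigenvalues (R : rcfType) (n : nat) (A : 'M[R]_n) :
  A^T = A -> size (eigenvalues A) = n.
Proof.
move=> symA; rewrite size_sort size_flatten /shape -map_comp.
rewrite (eq_map (g := fun a => \rank (eigenspace A a))); last first.
  by move=> a /=; rewrite size_nseq.
have := symmetric_sum_eigenspaces symA.
rewrite sumnE big_map; set s := rootsR _ => h.
rewrite (big_nth 0) big_mkord; move: h.
rewrite (big_nth 0) big_mkord sub1mx /row_full.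
have dir : mxdirect (\sum_(i < size s) eigenspace A s`_i).
  apply: mxdirect_sum_eigenspace => i j _ _ ij; apply/val_inj.
  by apply: uniqP ij; rewrite ?inE // uniq_roots.
by move=> /eqP; rewrite (mxdirectP dir).
Qed.

Lemma mem_eigenvalues (R : rcfType) (n : nat) (A : 'M[R]_n) (r : R) :
  (r \in eigenvalues A) = eigenvalue A r.
Proof.
have cp0 : char_poly A != 0 by rewrite monic_neq0 // char_poly_monic.
rewrite mem_sort; apply/flatten_mapP/idP => [[s _ /nseqP[-> ]]|Er].
  by rewrite lt0n mxrank_eq0.
exists r.
  by rewrite -(roots_on_rootsR cp0) in_itv /= -eigenvalue_root_char.
by rewrite mem_nseq eqxx andbT lt0n mxrank_eq0.
Qed.

Lemma sorted_eigenvalues (R : rcfType) (n : nat) (A : 'M[R]_n) :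
  sorted <=%R (eigenvalues A).
Proof. exact: (sort_sorted le_total). Qed.

Lemma eigenvalue_le_lambda_max (R : rcfType) (n : nat) (A : 'M[R]_n) (r : R) :
  A^T = A -> eigenvalue A r -> r <= lambda n A.
Proof.
move=> symA; rewrite -mem_eigenvalues => rin.
have sz := size_eigenvalues symA.
have n0 : (0 < n)%N by rewrite -sz; case: eigenvalues rin.
(* At most [n.-1] entries lie strictly below [r], since [r] is itself an entry; so the last one, at
   index [n.-1], is at least [r]. *)
apply: nth_count_ge; rewrite ?sorted_eigenvalues // sz prednK ?leqnn ?andbT //.
rewrite -ltnS prednK // -[X in (_ < X)%N]sz.
rewrite -(count_predC (< r) (eigenvalues A)) -[X in (X < _)%N]addn0 ltn_add2l.
by rewrite -has_count; apply/hasP; exists r => //=; rewrite ltxx.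
Qed.

Lemma count_eigenvalues (R : rcfType) (n : nat) (A : 'M[R]_n) (r : R) :
  count_mem r (eigenvalues A) = multiplicity A r.
Proof.
have cp0 : char_poly A != 0 by rewrite monic_neq0 // char_poly_monic.
rewrite /eigenvalues count_sort count_flatten -map_comp sumnE big_map.
have [rin|rnotin] := boolP (r \in rootsR (char_poly A)).
  rewrite (bigD1_seq r) ?uniq_roots //= count_nseq /= eqxx mul1n big1 ?addn0 //.
  by move=> s sr; rewrite count_nseq /= (negbTE sr).
rewrite big1_seq => [|s /= sin]; last first.
  rewrite count_nseq /=; case: eqP => [sr|//].
  by rewrite -sr sin in rnotin.
symmetry; apply/eqP; rewrite mxrank_eq0.
move: rnotin; rewrite -(roots_on_rootsR cp0) in_itv /= -eigenvalue_root_char.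
by rewrite negbK.
Qed.

(** Two entries of the sorted list are at most [r]: either [s] and [r], or two copies of [r]. So the
    entry at index 1 is at most [r]. *)
Lemma lambda2_le (R : rcfType) (n : nat) (A : 'M[R]_n) (r s : R) :
  s <= r -> eigenvalue A s -> eigenvalue A r ->
  s != r \/ (1 < multiplicity A r)%N -> lambda 2 A <= r.
Proof.
move=> sr Es Er h; apply: nth_count_le; first exact: sorted_eigenvalues.
set e := eigenvalues A; case: h => [neq|mr].
  have -> : 2%N = ((count_mem s e > 0) + (count_mem r e > 0))%N.
    by rewrite -!has_count !has_pred1 !mem_eigenvalues Es Er.
  apply: (@leq_trans (count_mem s e + count_mem r e)).
    by apply: leq_add; case: (count_mem _ _).
  rewrite -count_predUI [X in (_ + X)%N](_ : _ = 0%N) ?addn0; last first.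
    apply/eqP; rewrite -leqn0 leqNgt -has_count; apply/hasPn => x _ /=.
    by apply/negP => /andP[/eqP-> /eqP]; apply/eqP.
  by apply: sub_count => x /= /orP[] /eqP->.
apply: leq_trans mr _; rewrite -count_eigenvalues.
by apply: sub_count => x /= /eqP->.
Qed.

Lemma symmetric_eigen_orthogonal (R : rcfType) (n : nat) (A : 'M[R]_n)
    (r s : R) (x y : 'rV[R]_n) :
  A^T = A -> x *m A = r *: x -> y *m A = s *: y -> r != s -> x *m y^T = 0.
Proof.
move=> symA xA yA rs.
have : r *: (x *m y^T) = s *: (x *m y^T).
  by rewrite scalemxAl -xA -mulmxA -{1}symA -trmx_mul yA linearZ /= scalemxAr.
move/eqP; rewrite -subr_eq0 -scalerBl scaler_eq0 subr_eq0 (negbTE rs).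
by move/eqP.
Qed.

Lemma symmetric_eigen_decomposition (R : rcfType) (n : nat) (A : 'M[R]_n)
    (x : 'rV[R]_n) : A^T = A ->
  exists (m : nat) (r : 'I_m -> R) (y : 'I_m -> 'rV[R]_n),
    [/\ injective r, forall i, y i *m A = r i *: y i & x = \sum_i y i].
Proof.
move=> symA; have := submx_trans (submx1 x) (symmetric_sum_eigenspaces symA).
rewrite (big_nth 0) big_mkord => /sub_sumsmxP[u xE].
exists (size (rootsR (char_poly A))), (fun i => (rootsR (char_poly A))`_i).
exists (fun i => u i *m eigenspace A (rootsR (char_poly A))`_i).
split=> // [i j ij|i]; last by apply/eigenspaceP; rewrite submxMl.
by apply/val_inj; apply: uniqP ij; rewrite ?inE // uniq_roots.
Qed.

Lemma mulmx_tr_ge0 (R : realDomainType) (n : nat) (x : 'rV[R]_n) :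
  0 <= (x *m x^T) 0 0.
Proof.
by rewrite mxE; apply: sumr_ge0 => i _; rewrite mxE -expr2 sqr_ge0.
Qed.

Lemma mulmx_tr_gt0 (R : realDomainType) (n : nat) (x : 'rV[R]_n) :
  x != 0 -> 0 < (x *m x^T) 0 0.
Proof.
move=> x0; rewrite lt_def mulmx_tr_ge0 andbT; apply: contraNneq x0.
rewrite mxE => /eqP; rewrite psumr_eq0 => [/allP h|i _]; last first.
  by rewrite mxE -expr2 sqr_ge0.
apply/eqP/rowP => i; rewrite mxE; apply/eqP.
by have := h i (mem_index_enum i); rewrite mxE mulf_eq0 orbb.
Qed.

(** Eigenvectors for distinct eigenvalues of a symmetric matrix are orthogonal, so all cross terms
    vanish. *)
Lemma eigen_decomposition_forms (R : rcfType) (n m : nat) (A : 'M[R]_n)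
    (r : 'I_m -> R) (y : 'I_m -> 'rV[R]_n) :
  A^T = A -> injective r -> (forall i, y i *m A = r i *: y i) ->
  let x := \sum_i y i in
  (forall i, x *m (y i)^T = y i *m (y i)^T) /\
  x *m A *m x^T = \sum_i r i *: (y i *m (y i)^T).
Proof.
move=> symA rinj yA x.
have xy i : x *m (y i)^T = y i *m (y i)^T.
  rewrite mulmx_suml (bigD1 i) //= big1 ?addr0 // => j ji.
  apply: (symmetric_eigen_orthogonal symA (yA j) (yA i)).
  by rewrite (inj_eq rinj).
split=> //; rewrite -mulmxA.
have -> : A *m x^T = \sum_i r i *: (y i)^T.
  rewrite -{1}symA -trmx_mul mulmx_suml linear_sum /=.
  by apply: eq_bigr => i _; rewrite yA linearZ.
by rewrite mulmx_sumr; apply: eq_bigr => i _; rewrite -scalemxAr xy.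
Qed.

Lemma form_le_lambda_max (R : rcfType) (n : nat) (A : 'M[R]_n) (x : 'rV[R]_n) :
  A^T = A -> (x *m A *m x^T) 0 0 <= lambda n A * (x *m x^T) 0 0.
Proof.
move=> symA.
have [m [r [y [rinj yA xE]]]] := symmetric_eigen_decomposition x symA.
have [xy] := eigen_decomposition_forms symA rinj yA; rewrite -xE => ->.
have -> : x *m x^T = \sum_i y i *m (y i)^T.
  by rewrite {2}xE linear_sum mulmx_sumr; apply: eq_bigr => i _; rewrite xE xy.
rewrite !summxE mulr_sumr; apply: ler_sum => i _; rewrite mxE.
have [->|y0] := eqVneq (y i) 0; first by rewrite mul0mx mxE !mulr0.
apply: ler_wpM2r; first exact: mulmx_tr_ge0.
apply: eigenvalue_le_lambda_max => //.
by apply/eigenvalueP; exists (y i).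
Qed.

(** * The quadratic form of a graph Laplacian *)

Section Laplacian.
Variables (R : rcfType) (V : finType) (G : sgraph V).
Implicit Type f : V -> R.

Definition row_of f : 'rV[R]_#|V| := \row_i f (enum_val i).

Lemma row_of_onto (x : 'rV[R]_#|V|) : exists f, x = row_of f.
Proof.
by exists (fun v => x 0 (enum_rank v)); apply/rowP => i; rewrite mxE enum_valK.
Qed.

Lemma sum_enum_val f : \sum_(i < #|V|) f (enum_val i) = \sum_v f v.
Proof. by rewrite -(big_enum_val (A := V)). Qed.

Lemma laplacian_sym : (laplacian R G)^T = laplacian R G.
Proof.
apply/matrixP => i j; rewrite !mxE adj_sym eq_sym.
by case: eqP => // ->.
Qed.

Lemma row_of_mul_laplacian f :
  row_of f *m laplacian R G
    = row_of (fun v => \sum_(u | adj G v u) (f v - f u)).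
Proof.
apply/rowP => j; rewrite !mxE; set v := enum_val j.
under eq_bigr do rewrite !mxE mulrBr.
rewrite sumrB (bigD1 j) //= eqxx mulr1n big1 ?addr0 => [|i ij]; last first.
  by rewrite mulrb (negbTE ij) /= mulr0.
rewrite (sum_enum_val (fun u => f u * (adj G u v)%:R)) sumrB; congr (_ - _).
  by rewrite sumr_const /degree cardsE mulr_natr.
rewrite [RHS]big_mkcond /=; apply: eq_bigr => u _.
by rewrite adj_sym; case: adj; rewrite ?mulr1 ?mulr0.
Qed.

Lemma row_of_dot f g : (row_of f *m (row_of g)^T) 0 0 = \sum_v f v * g v.
Proof.
rewrite mxE -(sum_enum_val (fun v => f v * g v)).
by apply: eq_bigr => i _; rewrite !mxE.
Qed.

(** Each edge appears as two ordered pairs, whence the doubled form. Exchanging [u] and [v] in one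
    copy pairs [f u * (f u - f v)] with [f v * (f v - f u)], whose sum is a square. *)
Lemma laplacian_form f :
  (row_of f *m laplacian R G *m (row_of f)^T) 0 0 *+ 2
    = \sum_u \sum_(v | adj G u v) (f u - f v) ^+ 2.
Proof.
rewrite row_of_mul_laplacian row_of_dot mulr2n.
under eq_bigr do rewrite mulr_suml.
rewrite {2}(exchange_big_dep xpredT) //= -big_split /=; apply: eq_bigr => u _.
under [X in _ + X]eq_bigl do rewrite adj_sym.
by rewrite -big_split; apply: eq_bigr => v _ /=; ring.
Qed.

Lemma laplacian_form_ge0 (x : 'rV[R]_#|V|) :
  0 <= (x *m laplacian R G *m x^T) 0 0.
Proof.
have [f ->] := row_of_onto x.
rewrite -(pmulrn_lge0 _ (ltn0Sn 1)) laplacian_form.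
by do 2!apply: sumr_ge0 => ? _; rewrite sqr_ge0.
Qed.

(** The bound holds on each nonzero eigencomponent [y i]: its eigenvalue is nonnegative, and if it
    is 0 then 0 has multiplicity at least 2, as the kernel contains both [y i] and the constants,
    and these are not proportional. *)
Lemma lambda2_le_laplacian_form f :
  \sum_v f v = 0 ->
  lambda 2 (laplacian R G) * \sum_v f v ^+ 2
    <= (row_of f *m laplacian R G *m (row_of f)^T) 0 0.
Proof.
set L := laplacian R G => f0; have symL : L^T = L by exact: laplacian_sym.
set x := row_of f.
have -> : \sum_v f v ^+ 2 = (x *m x^T) 0 0.
  by rewrite row_of_dot; apply: eq_bigr => v _; rewrite expr2.
have [m [r [y [rinj yL xE]]]] := symmetric_eigen_decomposition x symL.
have [xy] := eigen_decomposition_forms symL rinj yL; rewrite -xE => ->.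
rewrite -xE in xy.
have -> : x *m x^T = \sum_i y i *m (y i)^T.
  by rewrite {2}xE linear_sum mulmx_sumr; apply: eq_bigr => i _; rewrite xy.
rewrite !summxE mulr_sumr; apply: ler_sum => i _; rewrite [leRHS]mxE.
have [->|y0] := eqVneq (y i) 0; first by rewrite mul0mx mxE !mulr0.
apply: ler_wpM2r; first exact: mulmx_tr_ge0.
have yy := mulmx_tr_gt0 y0.
have r0 : 0 <= r i.
  have := laplacian_form_ge0 (y i); rewrite yL -scalemxAl mxE.
  by rewrite pmulr_lge0.
pose one := row_of (fun=> 1).
have oneL : one *m L = 0 *: one.
  rewrite row_of_mul_laplacian scale0r; apply/rowP => j; rewrite !mxE.
  by apply: big1 => u _; rewrite subrr.
have one0 : one != 0.
  (* If [one] were zero there would be no vertices, and [y i] would be zero too. *)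
  apply: contraNneq y0 => one0; apply/eqP/rowP => j.
  by have /rowP/(_ j)/eqP := one0; rewrite !mxE oner_eq0.
have E0 : eigenvalue L 0 by apply/eigenvalueP; exists one.
have Er : eigenvalue L (r i) by apply/eigenvalueP; exists (y i).
apply: (lambda2_le r0 E0 Er).
have [ri|] := eqVneq 0 (r i); last by left.
(* Were the eigenspace one-dimensional, [one] would be [c *: y i]; as [x] is orthogonal to [one] but
   not to [y i], this forces [c = 0]. *)
right; rewrite ltnNge; apply/negP => rk.
have yle : (y i <= eigenspace L (r i))%MS by apply/eigenspaceP.
have onele : (one <= eigenspace L (r i))%MS by apply/eigenspaceP; rewrite -ri.
have : (eigenspace L (r i) <= y i)%MS.
  by rewrite -(geq_leqif (mxrank_leqif_sup yle)) rank_rV y0.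
move=> /(submx_trans onele)/sub_rVP[c oneE].
have : x *m one^T = 0.
  apply/matrixP => p q; rewrite !ord1 row_of_dot mxE -[RHS]f0.
  by apply: eq_bigr => v _; rewrite mulr1.
rewrite oneE linearZ -scalemxAr /= xy => h.
have := congr1 (fun M : 'M_1 => M 0 0) h; rewrite /= mxE [RHS]mxE => /eqP.
rewrite mulf_eq0 (gt_eqF yy) orbF => /eqP c0.
by move/eqP: one0; apply; rewrite oneE c0 scale0r.
Qed.

End Laplacian.

(** * Transpositions acting on sets *)

Section Swap.
Variable V : finType.
Implicit Types (u v : V) (A B : {set V}).

(** The preimage equals the image, as a transposition is an involution, and membership in it unfolds
    directly. *)
Definition swap u v A := tperm u v @^-1: A.

Lemma in_swap u v A x : (x \in swap u v A) = (tperm u v x \in A).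
Proof. by rewrite inE. Qed.

Lemma swapK u v : involutive (swap u v).
Proof. by move=> A; apply/setP => x; rewrite !inE tpermK. Qed.

Lemma card_swap u v A : #|swap u v A| = #|A|.
Proof. exact/card_preimset/perm_inj. Qed.

Lemma swapC u v A : swap u v A = swap v u A.
Proof. by rewrite /swap tpermC. Qed.

Lemma swap_subset u v A B : (swap u v A \subset swap u v B) = (A \subset B).
Proof.
apply/subsetP/subsetP => AB x; last by rewrite !in_swap; apply: AB.
by have := AB (tperm u v x); rewrite !in_swap tpermK.
Qed.

Lemma swap_id u v A : (u \in A) = (v \in A) -> swap u v A = A.
Proof. by move=> uv; apply/setP => x; rewrite in_swap; case: tpermP => // ->. Qed.

Lemma setD_swap u v A : u \in A -> v \notin A -> A :\: swap u v A = [set u].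
Proof.
move=> uA vA; apply/setP => x; rewrite in_setD in_swap in_set1.
case: tpermP => [->|->|/eqP xu /eqP xv]; rewrite ?uA ?vA ?eqxx //.
  by rewrite (negbTE vA) andbF; apply/esym/negbTE; apply: contraNneq vA => ->.
by rewrite (negbTE xu) andNb.
Qed.

Lemma swap_setD u v A : u \in A -> v \notin A -> swap u v A :\: A = [set v].
Proof.
move=> uA vA; have := @setD_swap v u (swap u v A).
by rewrite !in_swap tpermL tpermR (swapC v u) swapK; apply.
Qed.

(** The sets agree away from [x] and [y], while [x] lies only in [A] and [y] only in [B]. *)
Lemma setD1_inj_swap A B x y :
  A :\: B = [set x] -> B :\: A = [set y] -> B = swap x y A.
Proof.
move=> /setP ABx /setP BAy; apply/setP => z; rewrite in_swap.
have := ABx x; rewrite !inE eqxx => /andP[xB xA].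
have := BAy y; rewrite !inE eqxx => /andP[yA yB].
have := ABx z; have := BAy z; rewrite !inE.
case: tpermP => [->|->|/eqP zx /eqP zy].
- by rewrite (negbTE xB) (negbTE yA).
- by rewrite yB xA.
rewrite (negbTE zx) (negbTE zy).
by case: (z \in A); case: (z \in B).
Qed.

End Swap.

(** * Token Laplacians and the operator D *)

Section Token.
Variables (R : rcfType) (V : finType) (G : sgraph V).
Implicit Types (F : {set V} -> R) (A B : {set V}) (u v : V) (k : nat).
Local Notation kset k := {A : {set V} | #|A| == k}.

(* The sum over ordered pairs counts each edge twice, hence the factor 1/2. *)
Definition set_laplacian F A : R :=
  2^-1 * \sum_u \sum_(v | adj G u v) (F A - F (swap u v A)).

(** Supersets of all sizes are summed; when [F] is supported on the k-sets and [B] has k - 1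
    elements, this is D. *)
Definition down F B : R := \sum_(A : {set V} | B \subset A) F A.

(** Each [swap u v] permutes the sets and preserves inclusion, so it commutes with summing over
    supersets. *)
Lemma set_laplacian_down F B :
  set_laplacian (down F) B = down (set_laplacian F) B.
Proof.
rewrite /set_laplacian /down -mulr_sumr; congr (_ * _).
rewrite [RHS]exchange_big; apply: eq_bigr => u _ /=.
rewrite [RHS]exchange_big; apply: eq_bigr => v _ /=.
rewrite sumrB; congr (_ - _).
rewrite (reindex_inj (inv_inj (swapK u v))) /=.
by apply: eq_bigl => A; rewrite swap_subset.
Qed.

(** [swap u v] moves [A] only when exactly one of [u] and [v] lies in [A]; the two orders of such a
    pair give equal terms, which absorbs the factor 1/2. *)
Lemma set_laplacian_half F A :
  set_laplacian F A
    = \sum_(u in A) \sum_(v | adj G u v && (v \notin A)) (F A - F (swap u v A)).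
Proof.
have E u v : F A - F (swap u v A)
    = (if (u \in A) && (v \notin A) then F A - F (swap u v A) else 0)
    + (if (v \in A) && (u \notin A) then F A - F (swap v u A) else 0).
  have [uv|] := eqVneq (u \in A) (v \in A).
    by rewrite swap_id // uv !andbN addr0 subrr.
  rewrite (swapC v u).
  by case: (u \in A); case: (v \in A) => //= _; rewrite ?addr0 ?add0r.
rewrite /set_laplacian.
under eq_bigr => u _.
  under eq_bigr => v _ do rewrite E.
  rewrite big_split.
  over.
rewrite big_split /= [X in _ + X](exchange_big_dep xpredT) //=.
under [X in _ + X]eq_bigr => u _.
  under eq_bigl => v do rewrite adj_sym.
  over.
rewrite -mulr2n -[X in _ * X]mulr_natl mulrA mulVf ?pnatr_eq0 // mul1r.
rewrite [RHS]big_mkcond; apply: eq_bigr => u _ /=.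
case: ifP => uA /=; last by apply: big1.
by rewrite -big_mkcondr.
Qed.

(** As [A] and [B] have k elements and share k - 1, both differences are singletons, and their
    elements are the two ends of the edge, in either order. *)
Lemma token_adjP k (A B : kset k) :
  token_adj G A B <->
  exists u v,
    [/\ u \in val A, v \notin val A, adj G u v & val B = swap u v (val A)].
Proof.
case: A B => [A cA] [B cB]; rewrite /token_adj /=; split; last first.
  move=> [u [v [uA vA uv ->]]]; apply/andP; split.
    rewrite -(eqP cA) -(cardsID (swap u v A) A) setD_swap // cards1 addn1.
    exact: eqxx.
  apply/existsP; exists u; apply/existsP; exists v.
  by rewrite uv setD_swap // swap_setD // eqxx.
move=> /andP[cAB /existsP[u /existsP[v /andP[uv /eqP uvE]]]].
have : #|A :\: B| == 1%N.
  by rewrite -(eqn_add2l #|A :&: B|) cardsID addn1 (eqP cAB).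
have : #|B :\: A| == 1%N.
  by rewrite -(eqn_add2l #|B :&: A|) cardsID addn1 setIC (eqP cAB).
move=> /cards1P[y yE] /cards1P[x xE]; exists x, y.
have := set11 x; rewrite -xE inE => /andP[xB xA].
have := set11 y; rewrite -yE inE => /andP[yA yB].
split=> //; last exact: setD1_inj_swap.
rewrite xE yE in uvE.
have xy : x != y by apply: contraNneq yA => <-.
have := set22 x y; have := set21 x y; rewrite uvE !inE.
move=> /orP[] /eqP xu /orP[] /eqP yv; rewrite xu yv //.
- by rewrite xu yv eqxx in xy.
- by rewrite adj_sym.
- by rewrite xu yv eqxx in xy.
Qed.

(** Realizes every L_k as a restriction of one operator on functions of all sets, which makes L_k
    and L_{k-1} comparable. *)
Lemma token_graph_laplacian F k :
  row_of (F \o val) *m laplacian R (token_graph G k)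
    = row_of (set_laplacian F \o val).
Proof.
rewrite row_of_mul_laplacian; apply/rowP => i; rewrite !mxE /=.
case: (enum_val i) => A /= cA; set A' := exist _ A cA.
rewrite set_laplacian_half pair_big_dep /=.
pose P := [set p : V * V | (p.1 \in A) && (adj G p.1 p.2 && (p.2 \notin A))].
transitivity (\sum_(p in P) (F A - F (swap p.1 p.2 A))); last first.
  by apply: eq_bigl => p; rewrite inE.
pose h (p : V * V) := swap p.1 p.2 A.
(* The pair is recovered from the two set differences of [A] and [swap u v A], so each neighbour is
   counted once. *)
have hinj : {in P &, injective h}.
  move=> [u v] [u' v']; rewrite !inE /= => /and3P[uA _ vA] /and3P[uA' _ vA'].
  rewrite /h /= => e; congr (_, _); apply/set1_inj.
    by rewrite -(setD_swap uA vA) -(setD_swap uA' vA') e.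
  by rewrite -(swap_setD uA vA) -(swap_setD uA' vA') e.
rewrite -(big_imset (fun B => F A - F B) hinj) /=.
rewrite (reindex_omap (val : kset k -> _) insub) /=; last first.
  move=> B /imsetP[p _ ->]; rewrite insubT //=.
  by rewrite /h card_swap.
apply: eq_bigl => B; rewrite valK eqxx andbT.
apply/idP/imsetP => [/token_adjP[u [v /= [uA vA uv BE]]]|[[u v]]].
  by exists (u, v) => //; rewrite inE /= uA uv.
rewrite inE /= => /and3P[uA uv vA] BE; apply/token_adjP.
by exists u, v.
Qed.

Definition down_mx k : 'M[R]_(#|{: kset k}|,
    #|{: kset k.-1}|) :=
  \matrix_(i, j) (val (enum_val j : kset k.-1)
    \subset val (enum_val i : kset k))%:R.

(** Functions on k-sets are treated as functions on all sets that vanish elsewhere, so that the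
    operators have one domain for all k. *)
Definition supported_on_card k F := forall A, #|A| != k -> F A = 0.

Lemma row_of_mul_down_mx F k :
  supported_on_card k F ->
  row_of (F \o val) *m down_mx k = row_of (down F \o val).
Proof.
move=> Fk; apply/rowP => j; rewrite !mxE /= /down; set B := val (enum_val j).
under eq_bigr do rewrite !mxE.
rewrite (sum_enum_val (fun A : kset k =>
  F (val A) * (B \subset val A)%:R)).
rewrite [RHS](bigID (fun A : {set V} => #|A| == k)) /=.
rewrite [X in _ + X]big1 ?addr0; last first.
  by move=> A /andP[_]; apply: Fk.
rewrite (reindex_omap (val : kset k -> _) insub) /=; last first.
  by move=> A /andP[_ cA]; rewrite insubT.
rewrite [RHS]big_mkcond; apply: eq_bigr => A _.
rewrite valK eqxx (valP A) !andbT.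
by case: ifP; rewrite ?mulr1 ?mulr0.
Qed.

Definition set_extension k (f : kset k -> R) A : R :=
  if insub A is Some a then f a else 0.

Lemma set_extension_val k (f : kset k -> R) a :
  set_extension f (val a) = f a.
Proof. by rewrite /set_extension valK. Qed.

Lemma set_extension_supported k (f : kset k -> R) :
  supported_on_card k (set_extension f).
Proof. by move=> A cA; rewrite /set_extension insubN. Qed.

Lemma set_laplacian_supported k F :
  supported_on_card k F -> supported_on_card k (set_laplacian F).
Proof.
move=> Fk A cA; rewrite /set_laplacian big1 ?mulr0 // => u _.
by apply: big1 => v _; rewrite !Fk ?card_swap // subrr.
Qed.

Lemma row_of_extension k (x : 'rV[R]_#|{: kset k}|) :
  exists2 F, supported_on_card k F & x = row_of (F \o val).
Proof.
have [f ->] := row_of_onto x.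
exists (set_extension f); first exact: set_extension_supported.
by apply/rowP => i; rewrite !mxE /= set_extension_val.
Qed.

Lemma laplacian_down_mx k :
  laplacian R (token_graph G k) *m down_mx k
    = down_mx k *m laplacian R (token_graph G k.-1).
Proof.
apply/row_matrixP => i; rewrite !rowE !mulmxA.
(* A basis vector, extended by zero to all sets, reduces the claim to [set_laplacian_down]. *)
have [F Fk ->] := row_of_extension (delta_mx 0 i).
rewrite token_graph_laplacian !row_of_mul_down_mx //; last first.
  exact: set_laplacian_supported.
rewrite token_graph_laplacian; apply/rowP => j.
by rewrite !mxE /= set_laplacian_down.
Qed.

Lemma nontrivial_eigenvector k (a : R) :
  nontrivial_eigenvalue G k a ->
  exists F, [/\ supported_on_card k F, exists A, F A != 0,
    forall A, set_laplacian F A = a * F A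
    & forall B, #|B| = k.-1 -> down F B = 0].
Proof.
set L := laplacian R (token_graph G k).
set L' := laplacian R (token_graph G k.-1).
move=> [_ ltm].
pose E := eigenspace L a; pose K := (E :&: kermx (down_mx k))%MS.
have ED : (E *m down_mx k <= eigenspace L' a)%MS.
  apply/eigenspaceP; rewrite -mulmxA -laplacian_down_mx mulmxA scalemxAl.
  by congr (_ *m _); apply/eigenspaceP.
have : K != 0.
  (* Rank-nullity: the ranks of [E *m down_mx k] and [K] add up to that of [E], and the first is at
     most the multiplicity of [a] in [L'], which is smaller. *)
  rewrite -mxrank_eq0 -lt0n -(ltn_add2l (\rank (E *m down_mx k))).
  rewrite mxrank_mul_ker addn0; apply: leq_ltn_trans ltm.
  exact: mxrankS.
move=> /rowV0Pn[x]; rewrite sub_capmx.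
move=> /andP[/eigenspaceP xL /sub_kermxP xD] x0.
have [F Fk xE] := row_of_extension x; exists F; split=> //.
- apply/existsP; apply: contraR x0; rewrite negb_exists => /forallP F0.
  apply/eqP/rowP => i; rewrite xE !mxE /=; apply/eqP.
  by have := F0 (val (enum_val i)); rewrite negbK.
- move=> A; have [cA|cA] := boolP (#|A| == k); last first.
    by rewrite (set_laplacian_supported Fk) // Fk // mulr0.
  move: xL; rewrite xE token_graph_laplacian.
  move=> /rowP/(_ (enum_rank (exist _ A cA))).
  by rewrite !mxE enum_rankK.
move=> B /eqP cB.
move: xD; rewrite xE row_of_mul_down_mx //.
move=> /rowP/(_ (enum_rank (exist _ B cB))).
by rewrite !mxE enum_rankK.
Qed.

End Token.

(** * Sums over all B of the functions g_B *)

Section Star.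
Variables (R : rcfType) (V : finType) (G : sgraph V).
Implicit Types (F : {set V} -> R) (A B : {set V}) (u v : V).

(* The function g_B. *)
Definition star F B v : R := if v \in B then 0 else F (v |: B).

Lemma sum_setU1 u F :
  \sum_(B : {set V} | u \notin B) F (u |: B) = \sum_(A : {set V} | u \in A) F A.
Proof.
rewrite [RHS](reindex_onto (fun B => u |: B) (fun A => A :\ u)) /=; last first.
  by move=> A; apply: setD1K.
apply: eq_bigl => B; rewrite setU11 /=.
by apply/idP/eqP => [|<-]; [apply: setU1K | rewrite setD11].
Qed.

(** For [A = u |: B] with [v] not in [A], the set [v |: B] is [swap u v A]; terms with [u] or [v] in
    [B] vanish. *)
Lemma sum_star_mul F u v : u != v ->
  \sum_B star F B u * star F B v
    = \sum_(A : {set V} | (u \in A) && (v \notin A)) F A * F (swap u v A).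
Proof.
move=> uv; rewrite big_mkcondr /= -sum_setU1 [RHS]big_mkcond.
apply: eq_bigr => B _; rewrite /star.
have [uB|uB] /= := boolP (u \in B); first by rewrite mul0r.
rewrite in_setU1 eq_sym (negbTE uv) /=.
have [vB|vB] /= := boolP (v \in B); first by rewrite mulr0.
congr (_ * F _); apply/setP => x; rewrite in_swap !in_setU1.
case: tpermP => [->|->|/eqP/negbTE-> /eqP/negbTE-> //]; last by rewrite !eqxx.
by rewrite eq_sym (negbTE uB) (negbTE vB).
Qed.

Lemma sum_star_sqr F u :
  \sum_B star F B u ^+ 2 = \sum_(A : {set V} | u \in A) F A ^+ 2.
Proof.
rewrite -sum_setU1 [RHS]big_mkcond; apply: eq_bigr => B _; rewrite /star.
by case: ifP => //= _; rewrite expr0n.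
Qed.

(** Expand the square and collect by [A]: one end in [A] accounts for the terms of the first sum,
    both ends in [A] give [F A ^+ 2] twice, and neither end gives nothing. *)
Lemma sum_star_edge F u v : u != v ->
  \sum_B (star F B u - star F B v) ^+ 2
    = \sum_A F A * (F A - F (swap u v A))
      + (\sum_(A : {set V} | (u \in A) && (v \in A)) F A ^+ 2) *+ 2.
Proof.
move=> uv; have vu : v != u by rewrite eq_sym.
transitivity (\sum_B star F B u ^+ 2 + \sum_B star F B v ^+ 2
  - (\sum_B star F B u * star F B v + \sum_B star F B v * star F B u)).
  by rewrite -!big_split -sumrB; apply: eq_bigr => B _ /=; ring.
rewrite !sum_star_sqr (sum_star_mul F uv) (sum_star_mul F vu).
rewrite !(big_mkcond (fun A : {set V} => _ \in A)).
rewrite !(big_mkcond (fun A : {set V} => _ && _)).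
rewrite -sumrMnl -!big_split -sumrB; apply: eq_bigr => A _ /=.
have [uA|uA] := boolP (u \in A); have [vA|vA] := boolP (v \in A) => /=.
- by rewrite swap_id ?uA ?vA //; ring.
- by ring.
- by rewrite (swapC v u); ring.
by rewrite swap_id ?(negbTE uA) ?(negbTE vA) //; ring.
Qed.

(** If [B] has k - 1 elements, the k-sets containing it are the [v |: B] with [v] outside [B], so
    the sum is [down F B]; otherwise no such [v |: B] is a k-set and every term vanishes. *)
Lemma sum_star0 F k B : (0 < k)%N -> supported_on_card k F ->
  (#|B| = k.-1 -> down F B = 0) -> \sum_v star F B v = 0.
Proof.
move=> k0 Fk dF; have [cB|cB] := eqVneq #|B| k.-1; last first.
  apply: big1 => v _; rewrite /star; case: ifP => // /negbT vB.
  apply: Fk; rewrite cardsU1 vB add1n; apply: contraNneq cB => <-.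
  exact: eqxx.
rewrite -[RHS](dF cB) /star (bigID (mem B)) /= big1 ?add0r => [|v ->] //.
have uinj : {in [predC B] &, injective (fun v => v |: B)}.
  move=> u v /= uB vB /setP/(_ u); rewrite !inE in uB vB.
  by rewrite !in_setU1 eqxx (negbTE uB) !orbF => /esym/eqP.
rewrite (eq_bigr (fun v => F (v |: B))) => [|v /negbTE->] //.
rewrite -(big_imset F uinj) /= /down.
rewrite [RHS](bigID (fun A : {set V} => #|A| == k)) /=.
rewrite [X in _ = _ + X]big1 ?addr0 => [|A /andP[_]]; last exact: Fk.
apply: eq_bigl => A; apply/imsetP/andP => [[v vB ->]|[BA cA]].
  by rewrite subsetUr cardsU1 (negbTE vB) cB add1n prednK.
have : #|A :\: B| == 1%N.
  by rewrite cardsDS // cB (eqP cA) -{1}(prednK k0) subSnn.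
move=> /cards1P[v AB]; exists v.
  by have := set11 v; rewrite -AB !inE => /andP[].
by rewrite -AB -{1}(setID A B) (setIidPr BA) setUC.
Qed.

(** Twice the number of edges of [G] inside [A]. *)
Definition inner_degree A : nat := \sum_(u in A) #|[set v in A | adj G u v]|.

Lemma inner_degree_le A : (inner_degree A <= #|A| * #|A|.-1)%N.
Proof.
rewrite -sum_nat_const; apply: leq_sum => u uA.
rewrite [X in X.-1](cardsD1 u) uA; apply/subset_leq_card/subsetP => v.
rewrite !inE => /andP[-> uv]; rewrite andbT.
by apply: contraTneq uv => ->; rewrite adj_irr.
Qed.

(** Once doubled, the forms are sums over ordered adjacent pairs, and [sum_star_edge] splits them
    into the Laplacian part and the pairs lying inside [A]. *)
Lemma sum_star_form F :
  \sum_B (row_of (star F B) *m laplacian R G *m (row_of (star F B))^T) 0 0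
    = \sum_A F A * set_laplacian G F A + \sum_A F A ^+ 2 *+ inner_degree A.
Proof.
apply/eqP; rewrite -(eqr_pMn2r (ltn0Sn 1)); apply/eqP.
rewrite mulrnDl -!sumrMnl.
under eq_bigr do rewrite laplacian_form.
rewrite exchange_big /=.
under eq_bigr => u _.
  rewrite exchange_big /=.
  under eq_bigr => v uv.
    rewrite sum_star_edge; last by apply: contraTneq uv => ->; rewrite adj_irr.
    over.
  rewrite big_split /=.
  over.
rewrite big_split /=; congr (_ + _).
  under eq_bigr do rewrite exchange_big /=.
  rewrite exchange_big /=; apply: eq_bigr => A _.
  (* The doubling cancels the factor 1/2 in [set_laplacian]. *)
  rewrite /set_laplacian mulrCA -[RHS]mulr_natl mulVKf ?pnatr_eq0 //.
  by rewrite mulr_sumr; apply: eq_bigr => u _; rewrite mulr_sumr.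
rewrite [RHS]sumrMnl; under eq_bigr do rewrite sumrMnl.
rewrite sumrMnl; congr (_ *+ 2).
under eq_bigr do rewrite (exchange_big_dep xpredT) //=.
rewrite exchange_big /=; apply: eq_bigr => A _.
rewrite /inner_degree -sumrMnr [RHS]big_mkcond; apply: eq_bigr => u _ /=.
rewrite sumr_const.
case: ifP => uA.
  by congr (_ *+ _); apply: eq_card => v; rewrite !inE unfold_in andbC.
by rewrite eq_card0 ?mulr0n // => v; rewrite unfold_in andbF.
Qed.

End Star.

(** * Bounds on a non-trivial eigenvalue *)

Theorem theorem1p2 (R : rcfType) (V : finType) (G : sgraph V) (n k : nat)
    (hn : #|V| = n) (hk : (1 <= k <= n./2)%N) (a : R)
    (ha : nontrivial_eigenvalue G k a) :
  k%:R * (lambda 2 (laplacian R G) - k%:R + 1) <= a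
    <= k%:R * lambda n (laplacian R G).
Proof.
have /andP[k0 _] := hk.
have [F [Fk [A0 FA0] LF DF]] := nontrivial_eigenvector ha.
pose S := \sum_A F A ^+ 2.
have S0 : 0 < S.
  rewrite lt_def sumr_ge0 ?andbT => [|A _]; last exact: sqr_ge0.
  rewrite psumr_neq0 => [|A _]; last exact: sqr_ge0.
  by apply/hasP; exists A0; rewrite ?mem_index_enum // exprn_even_gt0.
pose E := \sum_A F A ^+ 2 *+ inner_degree G A.
have E0 : 0 <= E by apply: sumr_ge0 => A _; rewrite mulrn_wge0 // sqr_ge0.
(* Each vertex of a k-set has at most k - 1 neighbours in it; sets of other sizes contribute 0. *)
have Ek : E <= S * (k%:R * (k%:R - 1)).
  rewrite mulr_suml; apply: ler_sum => A _.
  have [cA|cA] := eqVneq #|A| k; last by rewrite Fk // expr0n mul0rn mul0r.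
  rewrite -mulr_natr; apply: ler_wpM2l; first exact: sqr_ge0.
  have := inner_degree_le G A; rewrite cA -(ler_nat R) => /le_trans; apply.
  by rewrite natrM -subn1 natrB.
have star_norm : \sum_B \sum_v star F B v ^+ 2 = k%:R * S.
  rewrite exchange_big /=; under eq_bigr do rewrite sum_star_sqr.
  rewrite (exchange_big_dep xpredT) //= mulr_sumr; apply: eq_bigr => A _.
  rewrite sumr_const; have [cA|cA] := eqVneq #|A| k.
    by rewrite cA mulr_natl.
  by rewrite Fk // expr0n mul0rn mulr0.
have form :
    \sum_B (row_of (star F B) *m laplacian R G *m (row_of (star F B))^T) 0 0
    = a * S + E.
  rewrite sum_star_form; congr (_ + _); rewrite mulr_sumr.
  by apply: eq_bigr => A _; rewrite LF; ring.
have lower : lambda 2 (laplacian R G) * (k%:R * S) <= a * S + E.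
  rewrite -form -star_norm mulr_sumr; apply: ler_sum => B _.
  apply: lambda2_le_laplacian_form; exact: (sum_star0 k0 Fk (DF B)).
have upper : a * S + E <= lambda n (laplacian R G) * (k%:R * S).
  rewrite -form -star_norm mulr_sumr -hn; apply: ler_sum => B _.
  apply: le_trans (form_le_lambda_max _ (laplacian_sym R G)) _.
  by rewrite row_of_dot; under eq_bigr do rewrite -expr2.
(* After multiplication by [S > 0], the lower bound follows with [Ek] and the upper bound with
   [E0]. *)
by apply/andP; split; rewrite -(ler_pM2r S0); lra.
Qed.
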